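(* Let $T\subset\mathbb{R}^3$ be a (nondegenerate) tetrahedron and, for $k=2,3$, let $$\mathfrak{B}_{k+1}(T)=\Big\{v\in P_{k+1}(T)\ \Big|\ \int_F v\,q\,ds=0\ \text{ for all } q\in P_{k-1}(F)\text{ and all } F\in\mathcal{F}(T)\Big\}.$$ Then $$\dim\mathfrak{B}_3(T)=8,\qquad \dim\mathfrak{B}_4(T)=11.$$
   Context: $P_m(S)$ denotes the space of real polynomials of degree at most $m$ on $S$ (for $S$ a tetrahedron or a triangular face). $\mathcal{F}(T)$ is the set of the four (closed triangular) faces of $T$. *)

(* Defs.v *)
From mathcomp Require Import all_boot all_order all_algebra.
From mathcomp Require mpoly.

Set Implicit Arguments.
Unset Strict Implicit.
Unset Printing Implicit Defensive.

(* The notations of mpoly clash with those of the analysis library: mpoly is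
   only imported inside this module, before the analysis library is loaded. *)
Module PolyFun.
Import mpoly GRing.Theory.
Local Open Scope ring_scope.

(* [f] is a polynomial function on K^d of total degree at most [m]. Note that
   [msize p] is the total degree plus one, and [msize 0] is 0. *)
Definition polyfun (K : comNzRingType) (d m : nat) (f : 'rV[K]_d -> K) : Prop :=
  exists2 p : {mpoly K[d]},
    (msize p <= m.+1)%N & forall x : 'rV[K]_d, f x = p.@[fun i => x ord0 i].

End PolyFun.

From mathcomp Require Import all_classical all_reals all_analysis.

Import Order.TTheory GRing.Theory Num.Theory.
Local Open Scope classical_set_scope.
Local Open Scope ring_scope.

(* [W] is a linear subspace of dimension [n]: it is the set of linear
   combinations of a linearly independent family of [n] vectors. *)
Definition has_dim (K : fieldType) (V : lmodType K) (W : set V) (n : nat) : Prop :=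
  exists b : 'I_n -> V,
    (forall c : 'I_n -> K, \sum_(i < n) c i *: b i = 0 -> forall i, c i = 0) /\
    (forall v, W v <-> exists c : 'I_n -> K, v = \sum_(i < n) c i *: b i).

Section Geometry.
Variable R : realType.

Definition affine_independent (n d : nat) (a : 'I_n.+1 -> 'rV[R]_d) : Prop :=
  row_free (\matrix_(i < n) (a (lift ord0 i) - a ord0)).

Definition convex_hull (n d : nat) (a : 'I_n -> 'rV[R]_d) : set 'rV[R]_d :=
  [set x | exists w : 'I_n -> R,
    [/\ forall i, 0 <= w i, \sum_(i < n) w i = 1 & x = \sum_(i < n) w i *: a i]].

(* Vertices of the face opposite to the vertex [a j]. *)
Definition face_vertices (a : 'I_4 -> 'rV[R]_3) (j : 'I_4) : 'I_3 -> 'rV[R]_3 :=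
  fun i => a (lift j i).

(* P_m(S): restrictions to [S] of polynomials of degree at most [m]; for a
   planar triangle [S] these are the polynomials of degree at most [m] in two
   affine coordinates of its plane. A function on [S] is encoded by its
   extension by 0 to the whole space. The codomain is [R^o] rather than [R] so
   that the functions form an [lmodType R]. *)
Definition Pspace (m : nat) (S : set 'rV[R]_3) : set ('rV[R]_3 -> R^o) :=
  [set f | exists2 p : 'rV[R]_3 -> R,
    PolyFun.polyfun m p & f = patch (fun=> 0) S p].

Definition ref_triangle : set (R * R) :=
  [set z | [/\ 0 <= z.1, 0 <= z.2 & z.1 + z.2 <= 1]].

(* Surface integral over the triangle with vertices [t 0], [t 1], [t 2],
   through the parametrisation
   (x, y) |-> t 0 + x (t 1 - t 0) + y (t 2 - t 0) of the triangle; the area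
   factor is the square root of the Gram determinant of the two edges. *)
Definition triangle_edges (t : 'I_3 -> 'rV[R]_3) : 'M[R]_(2, 3) :=
  \matrix_(i < 2) (t (lift ord0 i) - t ord0).

Definition triangle_param (t : 'I_3 -> 'rV[R]_3) (z : R * R) : 'rV[R]_3 :=
  t ord0 + z.1 *: row ord0 (triangle_edges t) + z.2 *: row ord_max (triangle_edges t).

Definition surface_integral (t : 'I_3 -> 'rV[R]_3) (f : 'rV[R]_3 -> R) : R :=
  Num.sqrt (\det (triangle_edges t *m (triangle_edges t)^T)) *
  Rintegral (@lebesgue_measure R \x @lebesgue_measure R)%E ref_triangle
    (fun z => f (triangle_param t z)).

(* The space B_{k+1}(T), for [T] the tetrahedron with vertices [a] and k >= 1. *)
Definition bubble_space (a : 'I_4 -> 'rV[R]_3) (k : nat) : set ('rV[R]_3 -> R^o) :=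
  [set v | Pspace k.+1 (convex_hull a) v /\
    forall (j : 'I_4) (q : 'rV[R]_3 -> R^o),
      Pspace k.-1 (convex_hull (face_vertices a j)) q ->
      surface_integral (face_vertices a j) (fun x => v x * q x) = 0].

End Geometry.

(* Main.v *)
Require Import Defs.
From mathcomp Require Import all_boot all_order all_algebra.
From mathcomp Require Import ring lra zify.
From mathcomp Require mpoly.

(** Write [w 0 .. w 3] for the barycentric coordinates of the tetrahedron and
[w^al] for the monomial with exponent vector [al].

Polynomials of degree at most [m] on the tetrahedron are exactly the forms of
degree [m] in the [w i]: since the [w i] sum to 1, lower order terms can be
multiplied by powers of that sum ([bernstein_expansion]).  The monomials [w^al]
with [|al| = m] stay linearly independent on the tetrahedron
([bform_eq0_simplex]), so dim P_3 = 20 and dim P_4 = 35.  Likewise P_(k-1) of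
a face has the monomials of degree [k - 1] in three coordinates as a spanning
family, with 3 members for [k = 2] and 6 for [k = 3].  The bubble space is thus
the kernel of 12, respectively 24, linear functionals on P_(k+1), one for each
pair of a face and a monomial on it, and the dimensions 8 = 20 - 12 and
11 = 35 - 24 amount to the linear independence of these functionals
([has_dim_kernel]).

On a triangle the integral of [w^ga] is twice the area times
[ga_0! ga_1! ga_2! / (|ga| + 2)!] ([dirichlet_integral]).  Up to a nonzero
factor depending only on the face, the integral over the face opposite to the
vertex [j] of [w^al w^be] is therefore [prod_i (al_i + be_i)!] if [al_j = 0],
and 0 otherwise ([bubble_face_integral]).

Independence means: if polynomials [q_j] of degree [k - 1] on the four faces
satisfy [sum_j int_(F_j) v q_j = 0] for all [v], where the area factors have
been absorbed in the [q_j], then every [q_j] vanishes.  Two kinds of test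
functions [v] suffice.

- Face bubbles [w_a^p w_b^q w_c^r] with positive exponents vanish on all the
  faces but one.  Let [x_ja] be the coefficient of [q_j] at the pure power
  [w_a^(k-1)].  For [k = 2] the bubble gives [x_ja + x_jb + x_jc = 0]; for
  [k = 3] the three bubbles determine the mixed coefficients of [q_j], the one
  at [w_a w_b] being [3/2 (x_jc - x_ja - x_jb)].
- Edge functions [w_a^p w_b^q] vanish on all the faces but the two that contain
  the edge [ab].  With the relations above, the moments on one face become
  linear in the [x_ja] ([edge_moments1], [edge_moments2]), and the resulting
  equations on each edge give [x_ja + x_ca = 0], for [j] and [c] the vertices
  off the edge.

For fixed [a] there are three faces containing [a], and the [x_ja] of any two of
them add up to 0; hence all three are 0 ([opposite_vertices_eq0]). *)

Set Implicit Arguments.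
Unset Strict Implicit.
Unset Printing Implicit Defensive.

(** * Polynomial functions *)

Module PolyFunTheory.
Import mpoly GRing.Theory.
Local Open Scope ring_scope.

Section PolyFunTheory.
Variables (K : comNzRingType) (d : nat).
Implicit Types f g : 'rV[K]_d -> K.

(** Forgets the type of multivariate polynomials: what matters below is only that a
polynomial function is a finite combination of monomials of bounded degree. *)
Lemma polyfun_expand m f : PolyFun.polyfun m f ->
  exists (s : seq {ffun 'I_d -> nat}) (c : {ffun 'I_d -> nat} -> K),
    (forall b, b \in s -> (\sum_i b i <= m)%N) /\
    (forall x, f x = \sum_(b <- s) c b * \prod_i x ord0 i ^+ b i).
Proof.
case=> p sp fE; exists [seq [ffun i => u i] | u : 'X_{1..d} <- msupp p].
exists (fun b => p@_[multinom b i | i < d]); split=> [b|x].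
  case/mapP=> u up ->; under eq_bigr do rewrite ffunE.
  by rewrite -mdegE -ltnS (leq_trans (msize_mdeg_lt up)).
rewrite fE mevalE [RHS]big_map; apply: eq_bigr => u _; congr (_ * _).
  by congr (mcoeff _ _); apply/mnmP=> i; rewrite mnmE ffunE.
by apply: eq_bigr => i _; rewrite ffunE.
Qed.

Lemma polyfun_ext m f g : f =1 g -> PolyFun.polyfun m f -> PolyFun.polyfun m g.
Proof. by move=> fg [p sp fE]; exists p => // x; rewrite -fg. Qed.

Lemma polyfun_cst m c : PolyFun.polyfun m (fun _ : 'rV[K]_d => c).
Proof. by exists c%:MP => [|x]; rewrite ?mevalC // msizeC; case: eqP. Qed.

Lemma polyfun_coord i : PolyFun.polyfun 1 (fun x : 'rV[K]_d => x ord0 i).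
Proof. by exists 'X_i => [|x]; rewrite ?mevalXU // msizeX mdeg1. Qed.

Lemma polyfunD m f g : PolyFun.polyfun m f -> PolyFun.polyfun m g ->
  PolyFun.polyfun m (fun x => f x + g x).
Proof.
move=> [p sp fE] [q sq gE]; exists (p + q) => [|x].
  by rewrite (leq_trans (msizeD_le _ _)) // geq_max sp.
by rewrite mevalD fE gE.
Qed.

Lemma polyfunM m n f g : PolyFun.polyfun m f -> PolyFun.polyfun n g ->
  PolyFun.polyfun (m + n) (fun x => f x * g x).
Proof.
move=> [p sp fE] [q sq gE]; exists (p * q) => [|x]; last by rewrite mevalM fE gE.
rewrite mmeasureE; apply/bigmax_leqP_seq => u /msuppM_le /allpairsP[[v w] /= [+ + ->]] _.
by move=> /msize_mdeg_lt vp /msize_mdeg_lt wq; rewrite mdegD; lia.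
Qed.

Lemma polyfun_sum m (I : eqType) (s : seq I) (F : I -> 'rV[K]_d -> K) :
  (forall i, i \in s -> PolyFun.polyfun m (F i)) ->
  PolyFun.polyfun m (fun x => \sum_(i <- s) F i x).
Proof.
elim: s => [_|i s IHs mF].
  by apply: polyfun_ext (polyfun_cst m 0) => x; rewrite big_nil.
apply: polyfun_ext (polyfunD (mF i (mem_head _ _)) (IHs _)) => [x|j js].
  by rewrite big_cons.
by apply: mF; rewrite inE js orbT.
Qed.

Lemma polyfunZ m a f : PolyFun.polyfun m f -> PolyFun.polyfun m (fun x => a * f x).
Proof. by rewrite -[m]add0n; apply: polyfunM; exact: polyfun_cst. Qed.

Lemma polyfunX m e f : PolyFun.polyfun m f ->
  PolyFun.polyfun (m * e) (fun x => f x ^+ e).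
Proof.
move=> mf; elim: e => [|e IHe]; first exact: polyfun_cst.
rewrite mulnS; apply: polyfun_ext (polyfunM mf IHe) => x; exact/esym/exprS.
Qed.

Lemma polyfun_prod (I : Type) (s : seq I) (e : I -> nat) (F : I -> 'rV[K]_d -> K) :
  (forall i, PolyFun.polyfun (e i) (F i)) ->
  PolyFun.polyfun (\sum_(i <- s) e i) (fun x => \prod_(i <- s) F i x).
Proof.
move=> mF; elim: s => [|i s IHs].
  by rewrite big_nil; apply: polyfun_ext (polyfun_cst 0 1) => x; rewrite big_nil.
by rewrite big_cons; apply: polyfun_ext (polyfunM (mF i) IHs) => x; rewrite big_cons.
Qed.

End PolyFunTheory.
End PolyFunTheory.

From mathcomp Require Import all_classical all_reals all_analysis.
From mathcomp Require Import measurable_realfun.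

Import PolyFunTheory.
Import Order.TTheory GRing.Theory Num.Theory.
Import numFieldNormedType.Exports.
Local Open Scope classical_set_scope.
Local Open Scope ring_scope.

(** * Forms in barycentric coordinates *)

(** The exponent vectors are lists of numbers rather than elements of a finite type,
so that sums over them unfold by computation when [n] and [m] are concrete. *)
Fixpoint exponents (n m : nat) : seq (seq nat) :=
  if n is n'.+1 then
    [seq i :: s | i <- iota 0 m.+1, s <- exponents n' (m - i)]
  else if m is 0 then [:: [::]] else [::].

Lemma exponentsS n m : exponents n.+1 m =
  [seq i :: s | i <- iota 0 m.+1, s <- exponents n (m - i)].
Proof. by []. Qed.

Lemma mem_exponents n m s : (s \in exponents n m) = (size s == n) && (sumn s == m).
Proof.
elim: n m s => [|n IHn] m s; first by case: m s => [|m] [|a s].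
rewrite exponentsS; apply/allpairsPdep/andP => [[i [t [+ + ->]]]|].
  rewrite mem_iota add0n ltnS IHn => /= im /andP[/eqP-> /eqP->].
  by rewrite subnKC.
case: s => [|a s] [] //= /eqP[sn] /eqP sm; exists a, s; split=> //.
  by rewrite -[_ :: _]/(iota 0 m.+1) mem_iota; lia.
by rewrite IHn sn eqxx; apply/eqP; lia.
Qed.

Lemma exponents_uniq n m : uniq (exponents n m).
Proof.
elim: n m => [|n IHn] m; first by case: m.
rewrite exponentsS; apply: allpairs_uniq_dep => [|i _|]; rewrite ?iota_uniq ?IHn // => -[i s] [j t] /= _ _.
by case=> -> ->.
Qed.

Lemma sumn_ord n s : size s = n -> sumn s = (\sum_(i < n) nth 0 s i)%N.
Proof. by move=> <-; rewrite sumnE (big_nth 0%N) big_mkord. Qed.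

Lemma exponents_delta (R : pzRingType) n m be (F : seq nat -> R) : be \in exponents n m ->
  \sum_(b <- exponents n m) (b == be)%:R * F b = F be.
Proof.
move=> beP; rewrite (bigD1_seq be) ?exponents_uniq //= eqxx mul1r big1 ?addr0 // => b /negPf->.
exact: mul0r.
Qed.

Definition mon (R : pzRingType) n (w : 'I_n -> R) (al : seq nat) : R :=
  \prod_(i < n) w i ^+ nth 0%N al i.

Definition bform (R : pzRingType) n m (c : seq nat -> R) (w : 'I_n -> R) : R :=
  \sum_(al <- exponents n m) c al * mon w al.

Section Independence.
Variable R : realFieldType.

Definition kronecker_code (B n : nat) (al : seq nat) := (\sum_(i < n) B ^ i * nth 0 al i)%N.

Lemma kronecker_codeS B n a al : kronecker_code B n.+1 (a :: al) = (a + B * kronecker_code B n al)%N.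
Proof.
rewrite /kronecker_code big_ord_recl expn0 mul1n big_distrr /=; congr addn.
by apply: eq_bigr => i _; rewrite expnS mulnA.
Qed.

Lemma kronecker_code_inj B n al be : size al = n -> size be = n ->
  all (fun i => i < B)%N al -> all (fun i => i < B)%N be ->
  kronecker_code B n al = kronecker_code B n be -> al = be.
Proof.
elim: n al be => [|n IHn] [|a al] [|b be] //= [sa] [sb] /andP[aB alB] /andP[bB beB].
rewrite !kronecker_codeS => e.
have ab : a = b.
  by move: (congr1 (modn^~ B) e); rewrite ![(_ + B * _)%N]addnC ![(B * _)%N]mulnC !modnMDl !modn_small.
rewrite ab (IHn al be) //.
by move: e; rewrite ab => /addnI/eqP; rewrite eqn_pmul2l => [/eqP //|]; lia.
Qed.

Lemma all_ltn_sumn s : all (fun i => i < (sumn s).+1)%N s.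
Proof.
apply/allP => a; elim: s => //= b s IHs; rewrite inE => /orP[/eqP->|/IHs]; lia.
Qed.

(** A nonzero polynomial has finitely many roots. *)
Lemma poly_eq0_pos (p : {poly R}) : (forall t, 0 < t -> p.[t] = 0) -> p = 0.
Proof.
move=> p0; pose rs := [seq i.+1%:R : R | i <- iota 0 (size p)].
apply: (@roots_geq_poly_eq0 _ p rs).
- by apply/allP => _ /mapP[i _ ->]; rewrite rootE p0 ?ltr0Sn.
- rewrite map_inj_uniq ?iota_uniq // => i j /eqP.
  by rewrite eqr_nat => /eqP[].
- by rewrite size_map size_iota.
Qed.

(** Kronecker substitution: putting [w i = t^(B^i)] with [B] larger than every
exponent turns distinct monomials into distinct powers of [t], so the vanishing
of the form for positive [w] is that of a univariate polynomial for [t > 0]. *)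
Lemma bform_eq0 n m (c : seq nat -> R) :
  (forall w : 'I_n -> R, (forall i, 0 < w i) -> bform m c w = 0) ->
  forall al, al \in exponents n m -> c al = 0.
Proof.
move=> c0 al alP; pose p := \sum_(be <- exponents n m) c be *: 'X^(kronecker_code m.+1 n be).
have p0 : p = 0.
  apply: poly_eq0_pos => t t0.
  rewrite -(c0 (fun i => t ^+ (m.+1 ^ i))) => [|i]; last exact: exprn_gt0.
  rewrite /p horner_sum; apply: eq_bigr => be _; rewrite hornerZ hornerXn; congr (_ * _).
  rewrite /kronecker_code /mon -prodrXr; apply: eq_bigr => i _; exact: exprM.
have := congr1 (fun q : {poly R} => q`_(kronecker_code m.+1 n al)) p0.
rewrite coef0 /p coef_sum (bigD1_seq al) ?exponents_uniq //= coefZ coefXn eqxx mulr1.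
rewrite big_seq_cond big1 ?addr0 // => be /andP[beP ne].
rewrite coefZ coefXn; case: eqP => [e|]; last by rewrite mulr0.
case/eqP: ne; move: beP alP; rewrite !mem_exponents => /andP[/eqP sb /eqP mb] /andP[/eqP sa /eqP ma].
by apply: kronecker_code_inj (esym e); rewrite // -?mb -?ma ?all_ltn_sumn // mb -ma all_ltn_sumn.
Qed.

Lemma monZ n m (w : 'I_n -> R) s al : al \in exponents n m ->
  mon (fun i => s * w i) al = s ^+ m * mon w al.
Proof.
rewrite mem_exponents => /andP[/eqP sa /eqP <-]; rewrite /mon.
under eq_bigr do rewrite exprMn.
by rewrite big_split /= prodrXr (sumn_ord sa).
Qed.

(** By homogeneity, a form that vanishes on the open simplex vanishes on the whole
open positive orthant. *)
Lemma bform_eq0_simplex n m (c : seq nat -> R) :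
  (forall w : 'I_n.+1 -> R, (forall i, 0 < w i) -> \sum_i w i = 1 -> bform m c w = 0) ->
  forall al, al \in exponents n.+1 m -> c al = 0.
Proof.
move=> c0; apply: bform_eq0 => w w0.
have s0 : 0 < \sum_i w i.
  by rewrite big_ord_recl ltr_wpDr ?w0 // sumr_ge0 // => i _; exact: ltW.
have -> : bform m c w = (\sum_i w i) ^+ m * bform m c (fun i => (\sum_i w i)^-1 * w i).
  rewrite /bform mulr_sumr; apply: eq_big_seq => al alP.
  by rewrite (monZ _ _ alP) mulrCA [_ ^+ m * (_ * _)]mulrA -exprMn divff ?gt_eqF // expr1n mul1r.
rewrite c0 ?mulr0 // => [i|]; first by rewrite mulr_gt0 ?invr_gt0.
by rewrite -mulr_sumr mulVf ?gt_eqF.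
Qed.

End Independence.

Section BernsteinExpansion.
Variables (R : comNzRingType) (n : nat).

(** Only the values at weights of sum 1 count, which is what makes a polynomial of
lower degree representable in degree [m] ([is_bform_leq]). *)
Definition is_bform m (f : ('I_n -> R) -> R) :=
  exists c, forall w, \sum_i w i = 1 -> f w = bform m c w.

Lemma is_bform_ext m f g : (forall w, \sum_i w i = 1 -> f w = g w) -> is_bform m f -> is_bform m g.
Proof. by move=> fg [c fc]; exists c => w w1; rewrite -fg // fc. Qed.

Lemma is_bform_mon m al : al \in exponents n m -> is_bform m (fun w => mon w al).
Proof.
by move=> alP; exists (fun be => (be == al)%:R) => w _; rewrite /bform exponents_delta.
Qed.

Lemma is_bformZ m a f : is_bform m f -> is_bform m (fun w => a * f w).
Proof.
move=> [c fc]; exists (fun al => a * c al) => w w1.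
by rewrite fc // /bform mulr_sumr; apply: eq_bigr => al _; rewrite mulrA.
Qed.

Lemma is_bform_sum m (I : eqType) (s : seq I) (F : I -> ('I_n -> R) -> R) :
  (forall i, i \in s -> is_bform m (F i)) -> is_bform m (fun w => \sum_(i <- s) F i w).
Proof.
elim: s => [_|i s IHs mF].
  by exists (fun=> 0) => w _; rewrite big_nil /bform big1 // => al _; rewrite mul0r.
have [c cE] := mF i (mem_head _ _).
have [|b bE] := IHs; first by move=> j js; apply: mF; rewrite inE js orbT.
exists (fun al => c al + b al) => w w1; rewrite big_cons cE // bE // -big_split /=.
by apply: eq_bigr => al _; rewrite mulrDl.
Qed.

Lemma is_bformM m p f g : is_bform m f -> is_bform p g -> is_bform (m + p) (fun w => f w * g w).
Proof.
move=> [c fc] [b gb]; apply: is_bform_ext (_ : is_bform _ (fun w =>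
    \sum_(al <- exponents n m) \sum_(be <- exponents n p) (c al * b be) *
      mon w (mkseq (fun i => nth 0 al i + nth 0 be i)%N n))) => [w w1|].
  rewrite fc // gb // mulr_suml; apply: eq_bigr => al _; rewrite mulr_sumr.
  apply: eq_bigr => be _; rewrite mulrACA; congr (_ * _); rewrite -big_split /=.
  by apply: eq_bigr => i _; rewrite nth_mkseq // exprD.
apply: is_bform_sum => al alP; apply: is_bform_sum => be beP.
apply/is_bformZ/is_bform_mon; move: alP beP; rewrite !mem_exponents size_mkseq eqxx /=.
move=> /andP[/eqP sa /eqP <-] /andP[/eqP sb /eqP <-].
rewrite (sumn_ord sa) (sumn_ord sb) (sumn_ord (size_mkseq _ _)) -big_split /=.
by apply/eqP/eq_bigr => i _; rewrite nth_mkseq.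
Qed.

Lemma is_bform_coord k : is_bform 1 (fun w => w k).
Proof.
apply: is_bform_ext (_ : is_bform 1 (fun w => mon w (mkseq (fun i => (i == k : nat)) n))) => [w _|].
  rewrite /mon (bigD1 k) //= nth_mkseq // eqxx expr1 big1 ?mulr1 // => i /negPf ik.
  by rewrite nth_mkseq // -[val i == val k]/(i == k) ik.
apply: is_bform_mon; rewrite mem_exponents size_mkseq eqxx (sumn_ord (size_mkseq _ _)) (bigD1 k) //=.
rewrite nth_mkseq // eqxx big1 // => i /negPf ik.
by rewrite nth_mkseq // -[val i == val k]/(i == k) ik.
Qed.

(** This is the power [m] of the sum of the weights. *)
Lemma is_bform1 m : is_bform m (fun=> 1).
Proof.
elim: m => [|m IHm].
  apply: is_bform_ext (is_bform_mon (_ : nseq n 0%N \in _)) => [w _|].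
    by rewrite /mon big1 // => i _; rewrite nth_nseq if_same.
  by rewrite mem_exponents size_nseq sumn_nseq mul0n !eqxx.
rewrite -addn1; apply: is_bform_ext (is_bformM IHm (_ : is_bform 1 (fun w => \sum_i w i))).
  by move=> w ->; rewrite mulr1.
by apply: is_bform_sum => i _; exact: is_bform_coord.
Qed.

Lemma is_bformX m e f : is_bform m f -> is_bform (m * e) (fun w => f w ^+ e).
Proof.
move=> mf; elim: e => [|e IHe]; first exact: is_bform1.
by rewrite mulnS; apply: is_bform_ext (is_bformM mf IHe) => w _; rewrite exprS.
Qed.

Lemma is_bform_prod (I : Type) (s : seq I) (e : I -> nat) F :
  (forall i, is_bform (e i) (F i)) ->
  is_bform (\sum_(i <- s) e i) (fun w => \prod_(i <- s) F i w).
Proof.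
move=> mF; elim: s => [|i s IHs].
  by rewrite big_nil; apply: is_bform_ext (is_bform1 0) => w _; rewrite big_nil.
by rewrite big_cons; apply: is_bform_ext (is_bformM (mF i) IHs) => w _; rewrite big_cons.
Qed.

Lemma is_bform_leq m p f : (m <= p)%N -> is_bform m f -> is_bform p f.
Proof.
move=> /subnKC <- mf; apply: is_bform_ext (is_bformM mf (is_bform1 (p - m))) => w _.
exact: mulr1.
Qed.

(** At a point with weights [w] each Cartesian coordinate is a linear form in [w].
The number of points is independent of the dimension, so that this covers both a
tetrahedron and its faces. *)
Lemma bernstein_expansion d m (t : 'I_n -> 'rV[R]_d) (p : 'rV[R]_d -> R) :
  PolyFun.polyfun m p -> is_bform m (fun w => p (\sum_i w i *: t i)).
Proof.
move=> /polyfun_expand[s [c [sm pE]]].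
apply: is_bform_ext (_ : is_bform m (fun w => \sum_(b <- s) c b *
   \prod_k (\sum_i w i * t i ord0 k) ^+ b k)) => [w _|].
  rewrite pE; apply: eq_bigr => b _; congr (_ * _); apply: eq_bigr => k _.
  by rewrite summxE; congr (_ ^+ _); apply: eq_bigr => i _; rewrite mxE.
apply: is_bform_sum => b /sm bm; apply/is_bformZ/(is_bform_leq bm)/is_bform_prod => k.
rewrite -[X in is_bform X]mul1n; apply/is_bformX/is_bform_sum => i _.
apply: is_bform_ext (is_bformZ (t i ord0 k) (is_bform_coord i)) => w _; exact: mulrC.
Qed.

End BernsteinExpansion.

(** * Dimension of a kernel *)

Section KernelDimension.
Variables (K : fieldType) (V : lmodType K) (S T : eqType) (s : seq S) (r : seq T).
Variables (f : S -> V) (M : S -> T -> K).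

(** The hypothesis on [y] says that the columns of [M] are independent, that is, that
[M] has rank [size r]; rank and nullity do the rest. *)
Lemma has_dim_kernel : uniq s -> uniq r ->
  (forall c : S -> K, \sum_(x <- s) c x *: f x = 0 -> {in s, forall x, c x = 0}) ->
  (forall y : T -> K, {in s, forall x, \sum_(t <- r) M x t * y t = 0} ->
     {in r, forall t, y t = 0}) ->
  has_dim [set v | exists c : S -> K,
      {in r, forall t, \sum_(x <- s) c x * M x t = 0} /\ v = \sum_(x <- s) c x *: f x]
    (size s - size r).
Proof.
move=> us ur f_free M_inj.
pose sx := tnth (in_tuple s); pose rt := tnth (in_tuple r).
pose A := \matrix_(i < size s, j < size r) M (sx i) (rt j).
(* The function on the entries of a list given by a row vector indexed by their
   positions. *)
pose ext (S' : eqType) (s' : seq S') (u : 'rV[K]_(size s')) (x : S') : K :=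
  oapp (u ord0) 0 (insub (index x s')).
have extE (S' : eqType) (s' : seq S') (u : 'rV[K]_(size s')) i :
    uniq s' -> ext S' s' u (tnth (in_tuple s') i) = u ord0 i.
  move=> us'; rewrite /ext (tnth_nth (tnth (in_tuple s') i)) index_uniq //.
  by rewrite insubT //= => lti; congr (u _ _); apply: val_inj.
have Arank : \rank A = size r.
  rewrite -mxrank_tr; apply/eqP; rewrite -[_ == _]/(row_free A^T) -kermx_eq0.
  apply/rowV0P => y /sub_kermxP yA; apply/rowP => j; rewrite mxE -(extE _ r y j ur).
  apply: M_inj; last exact: mem_tnth.
  move=> x /seq_tnthP[i ->]; move/rowP/(_ i): yA; rewrite [RHS]mxE => yA; rewrite -[RHS]yA [RHS]mxE big_tnth.
  by apply: eq_bigr => k _; rewrite (extE _ _ _ _ ur) !mxE mulrC.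
have kerk : \rank (kermx A) = (size s - size r)%N by rewrite mxrank_ker Arank.
rewrite -kerk; pose B := row_base (kermx A).
exists (fun i => \sum_j B i j *: f (sx j)).
have comb (c : 'I_(\rank (kermx A)) -> K) : \sum_i c i *: \sum_j B i j *: f (sx j) =
    \sum_j ((\row_i c i) *m B) ord0 j *: f (sx j).
  under [LHS]eq_bigr do rewrite scaler_sumr.
  rewrite exchange_big; apply: eq_bigr => j _; rewrite mxE scaler_suml.
  by apply: eq_bigr => i _; rewrite scalerA [(\row_i _) _ _]mxE.
split=> [c|v].
  rewrite comb => c0; have : (\row_i c i) *m B = 0.
    apply/rowP => j; rewrite [RHS]mxE -(extE _ s _ j us); apply: f_free; last exact: mem_tnth.
    by rewrite big_tnth -[RHS]c0; apply: eq_bigr => i _; rewrite (extE _ _ _ _ us).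
  move/eqP; rewrite mulmx_free_eq0 ?row_base_free // => /eqP/rowP cr i.
  by have := cr i; rewrite !mxE.
split=> [[c [cM ->]]|[c ->]].
  pose u := \row_j c (sx j).
  have /submxP[D uD] : (u <= B)%MS.
    rewrite eq_row_base; apply/sub_kermxP/rowP => j; rewrite !mxE.
    rewrite -[RHS](cM (rt j)) ?mem_tnth // [RHS]big_tnth.
    by apply: eq_bigr => i _; rewrite !mxE.
  exists (fun i => D ord0 i); rewrite comb big_tnth.
  have -> : \row_i D ord0 i = D by apply/rowP => i; rewrite mxE.
  by rewrite -uD; apply: eq_bigr => j _; rewrite mxE.
exists (ext _ s ((\row_i c i) *m B)); split=> [t /seq_tnthP[j ->]|]; last first.
  by rewrite comb [RHS]big_tnth; apply: eq_bigr => j _; rewrite (extE _ _ _ _ us).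
have /sub_kermxP : ((\row_i c i) *m B <= kermx A)%MS by rewrite -(eq_row_base (kermx A)) submxMl.
move=> /rowP /(_ j); rewrite [RHS]mxE => cBA; rewrite -[RHS]cBA [RHS]mxE big_tnth.
by apply: eq_bigr => i _; rewrite (extE _ _ _ _ us) [A _ _]mxE.
Qed.

End KernelDimension.

(** * Independence of the face moments *)

(** The exponent vector of a monomial restricted to the face opposite to the vertex
[j], whose vertices keep their order. *)
Definition del (j : nat) (al : seq nat) := take j al ++ drop j.+1 al.

(** The test monomials on the faces, a face being named by its opposite vertex. *)
Definition face_tests m := [seq (j, be) | j <- enum 'I_4, be <- exponents 3 m].

Section Moments.
Variable R : realFieldType.

(** The integral of [w^ga w^be] over a triangle, up to a factor that depends only on
the total degree and on the area. *)
Definition dirichlet_weight (ga be : seq nat) : R := (\prod_(i < 3) (nth 0 ga i + nth 0 be i)`!)%:R.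

Definition face_moment (al : seq nat) (t : 'I_4 * seq nat) : R :=
  if nth 0%N al t.1 == 0%N then dirichlet_weight (del t.1 al) t.2 else 0.

(** Up to a factor independent of [y], the integral of [w^ga] times the polynomial of
degree [m] with coefficients [y]. *)
Definition moment m (y : seq nat -> R) ga := \sum_(be <- exponents 3 m) dirichlet_weight ga be * y be.

Lemma face_moment_sum m al (y : 'I_4 * seq nat -> R) :
  \sum_(t <- face_tests m) face_moment al t * y t =
  \sum_(j < 4 | nth 0%N al j == 0%N) moment m (fun be => y (j, be)) (del j al).
Proof.
rewrite big_allpairs big_enum [RHS]big_mkcond; apply: eq_bigr => j _.
by rewrite /face_moment /=; case: eqP => // _; rewrite big1 // => be _; rewrite mul0r.
Qed.

Lemma moment1E y a b c : moment 1 y [:: a; b; c] =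
  (a.+1`! * b`! * c`!)%:R * y [:: 1; 0; 0]%N +
  (a`! * b.+1`! * c`!)%:R * y [:: 0; 1; 0]%N +
  (a`! * b`! * c.+1`!)%:R * y [:: 0; 0; 1]%N.
Proof.
rewrite /moment /dirichlet_weight /= !big_cons big_nil !big_ord_recl !big_ord0 /= !addn0 !addn1 !muln1.
rewrite !mulnA; lra.
Qed.

Lemma moment2E y a b c : moment 2 y [:: a; b; c] =
  (a.+2`! * b`! * c`!)%:R * y [:: 2; 0; 0]%N +
  (a`! * b.+2`! * c`!)%:R * y [:: 0; 2; 0]%N +
  (a`! * b`! * c.+2`!)%:R * y [:: 0; 0; 2]%N +
  (a`! * b.+1`! * c.+1`!)%:R * y [:: 0; 1; 1]%N +
  (a.+1`! * b`! * c.+1`!)%:R * y [:: 1; 0; 1]%N +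
  (a.+1`! * b.+1`! * c`!)%:R * y [:: 1; 1; 0]%N.
Proof.
rewrite /moment /dirichlet_weight /= !big_cons big_nil !big_ord_recl !big_ord0 /= !addn0 !addn1 !addn2 !muln1.
rewrite !mulnA; lra.
Qed.

Lemma face_moment_sum4 m (y : 'I_4 * seq nat -> R) al :
  let Y k := fun be => y (inord k, be) in
  \sum_(t <- face_tests m) face_moment al t * y t =
  (if nth 0%N al 0 == 0%N then moment m (Y 0) (del 0 al) else 0) +
  (if nth 0%N al 1 == 0%N then moment m (Y 1) (del 1 al) else 0) +
  (if nth 0%N al 2 == 0%N then moment m (Y 2) (del 2 al) else 0) +
  (if nth 0%N al 3 == 0%N then moment m (Y 3) (del 3 al) else 0).
Proof.
move=> Y; rewrite face_moment_sum big_mkcond.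
rewrite (eq_bigr (fun j : 'I_4 => if nth 0%N al j == 0%N then moment m (Y j) (del j al) else 0)).
  by rewrite !big_ord_recl big_ord0 /= addr0 !addrA.
by move=> j _; rewrite /Y inord_val.
Qed.

(** A face, given by its opposite vertex [j], together with a numbering [a], [b], [c]
of its vertices.  Letting the numbering vary replaces many explicit equations by
a few symmetric statements. *)
Definition frame (j a b c : nat) := perm_eq [:: j; a; b; c] [:: 0; 1; 2; 3]%N.

Lemma frame_ind (P : nat -> nat -> nat -> nat -> Prop) :
  (forall s, s \in permutations [:: 0; 1; 2; 3]%N ->
    P (nth 0 s 0) (nth 0 s 1) (nth 0 s 2) (nth 0 s 3))%N ->
  forall j a b c, frame j a b c -> P j a b c.
Proof. by move=> Ps j a b c fr; apply: (Ps [:: j; a; b; c]); rewrite mem_permutations. Qed.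

Ltac case_frames := apply: frame_ind => ?; rewrite /= !inE;
  repeat (case/orP => [/eqP->|]); [..|move/eqP->].

Definition exp3 (a b c p q r : nat) : seq nat :=
  [seq if i == a then p else if i == b then q else if i == c then r else 0 | i <- iota 0 4]%N.

Definition exp1 (a p : nat) : seq nat := [seq if i == a then p else 0 | i <- iota 0 4]%N.

Lemma exp3_exponents j a b c p q r : frame j a b c -> exp3 a b c p q r \in exponents 4 (p + q + r).
Proof.
by rewrite mem_exponents; move: j a b c; case_frames; rewrite /=; apply/eqP; lia.
Qed.

(** The monomial vanishes on the other three faces. *)
Lemma face_sum_bubble m y j a b c p q r : frame j a b c ->
  let al := exp3 a b c p.+1 q.+1 r.+1 in
  \sum_(t <- face_tests m) face_moment al t * y t =
  moment m (fun be => y (inord j, be)) (del j al).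
Proof.
by move: j a b c; case_frames; rewrite face_moment_sum4 /= ?add0r ?addr0.
Qed.

(** The edge [ab] belongs exactly to the faces opposite to [j] and to [c]. *)
Lemma face_sum_edge m y j a b c p q : frame j a b c ->
  let al := exp3 a b c p.+1 q.+1 0 in
  \sum_(t <- face_tests m) face_moment al t * y t =
  moment m (fun be => y (inord j, be)) (del j al) + moment m (fun be => y (inord c, be)) (del c al).
Proof.
by move: j a b c; case_frames; rewrite face_moment_sum4 /= ?add0r ?addr0 //; exact: addrC.
Qed.

Lemma exp3_edge a b c c' p q : exp3 a b c p q 0 = exp3 a b c' p q 0.
Proof. by apply: eq_map => i; rewrite !if_same. Qed.

Lemma frame_swap j a b c : frame j a b c -> frame c a b j.
Proof. by apply: perm_trans; apply/permP => P /=; lia. Qed.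

(** Reduces the choice of a numbering to a search that is run by computation. *)
Lemma frame_exists (P : nat -> nat -> nat -> nat -> bool) j :
  has (fun s => (nth 0 s 0 == j) && P j (nth 0 s 1) (nth 0 s 2) (nth 0 s 3))%N
    (permutations [:: 0; 1; 2; 3]%N) ->
  exists a b c, frame j a b c /\ P j a b c.
Proof.
case/hasP => s; rewrite mem_permutations => sP /andP[/eqP <-].
have := perm_size sP; case: s sP => [|i [|a [|b [|c []]]]] //= fr _ Ps.
by exists a, b, c.
Qed.

Lemma exponents1_frame j be : (j < 4)%N -> be \in exponents 3 1 ->
  exists a b c, frame j a b c /\ be == del j (exp1 a 1).
Proof.
move=> j4 beP; apply: (frame_exists (P := fun j a _ _ => be == del j (exp1 a 1))).
move: beP; rewrite !inE; case: j j4 => [|[|[|[|//]]]] _;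
  by repeat (case/orP=> [/eqP->|]); [..|move/eqP->].
Qed.

Lemma exponents2_frame j be : (j < 4)%N -> be \in exponents 3 2 ->
  exists a b c, frame j a b c /\
    (be == del j (exp1 a 2)) || (be == del j (exp3 a b c 1 1 0)).
Proof.
move=> j4 beP; apply: (frame_exists
  (P := fun j a b c => (be == del j (exp1 a 2)) || (be == del j (exp3 a b c 1 1 0)))).
move: beP; rewrite !inE; case: j j4 => [|[|[|[|//]]]] _;
  by repeat (case/orP=> [/eqP->|]); [..|move/eqP->].
Qed.

(** Three numbers of which any two have sum 0 are all 0. *)
Lemma opposite_vertices_eq0 (x : nat -> nat -> R) :
  (forall j a b c, frame j a b c -> x j a + x c a = 0) ->
  forall j a b c, frame j a b c -> x j a = 0.
Proof.
move=> xP j a b c fr; have := xP _ _ _ _ fr.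
have : x j a + x b a = 0.
  by apply: (xP j a c b); apply: perm_trans fr; apply/permP=> P /=; lia.
have : x b a + x c a = 0.
  by apply: (xP b a j c); apply: perm_trans fr; apply/permP=> P /=; lia.
lra.
Qed.

(** The moment [mu 1 1 1] is twice the sum of the coefficients; its vanishing
eliminates the coefficient at [c], which has weight 2 in the edge moments. *)
Lemma edge_moments1 (y : seq nat -> R) j a b c : frame j a b c ->
  let mu p q r := moment 1 y (del j (exp3 a b c p q r)) in let x i := y (del j (exp1 i 1)) in
  mu 1 1 1 = 0 -> mu 2 1 0 = 4 * x a + 2 * x b /\ mu 1 2 0 = 2 * x a + 4 * x b.
Proof.
move: j a b c; case_frames; by rewrite /exp3 /exp1 /= !moment1E !factS fact0 => h; split; lra.
Qed.

(** The three bubble moments form a linear system whose solution expresses the mixed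
coefficients of a quadratic polynomial by the pure ones; substituting it in the
edge moments gives the other formulas. *)
Lemma edge_moments2 (y : seq nat -> R) j a b c : frame j a b c ->
  let mu p q r := moment 2 y (del j (exp3 a b c p q r)) in let x i := y (del j (exp1 i 2)) in
  mu 2 1 1 = 0 -> mu 1 2 1 = 0 -> mu 1 1 2 = 0 ->
  [/\ y (del j (exp3 a b c 1 1 0)) = 3 / 2 * (x c - x a - x b),
      mu 3 1 0 = 30 * x a - 18 * x b + 30 * x c,
      mu 1 3 0 = 30 * x b - 18 * x a + 30 * x c &
      mu 2 2 0 = 26 * x c - 6 * x a - 6 * x b].
Proof.
move: j a b c; case_frames; by rewrite /exp3 /exp1 /= !moment2E !factS fact0 => h1 h2 h3; split; lra.
Qed.

(** On an edge [ab] put [A = x_ja + x_ca] and [B = x_jb + x_cb].  The tests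
[w_a^2 w_b] and [w_a w_b^2] give [4 A + 2 B = 0] and [2 A + 4 B = 0], so [A = 0]. *)
Lemma face_moments1_inj (y : 'I_4 * seq nat -> R) :
  {in exponents 4 3, forall al, \sum_(t <- face_tests 1) face_moment al t * y t = 0} ->
  {in face_tests 1, forall t, y t = 0}.
Proof.
move=> y0; pose Y j be := y (inord j, be).
have edge j a b c : frame j a b c ->
    let mu p q r := moment 1 (Y j) (del j (exp3 a b c p q r)) in
    mu 2 1 0 = 4 * Y j (del j (exp1 a 1)) + 2 * Y j (del j (exp1 b 1)) /\
    mu 1 2 0 = 2 * Y j (del j (exp1 a 1)) + 4 * Y j (del j (exp1 b 1)).
  move=> fr; apply: (edge_moments1 fr).
  by rewrite -(face_sum_bubble _ _ _ _ _ fr); exact/y0/(exp3_exponents 1 1 1 fr).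
have Y0 : forall j a b c, frame j a b c -> Y j (del j (exp1 a 1)) = 0.
  apply: (opposite_vertices_eq0 (x := fun j a => Y j (del j (exp1 a 1)))).
  move=> j a b c fr; have frc := frame_swap fr.
  have := y0 _ (exp3_exponents 2 1 0 fr); have := y0 _ (exp3_exponents 1 2 0 fr).
  rewrite !(face_sum_edge _ _ _ _ fr) -/(Y j) -/(Y c).
  have [-> ->] := edge _ _ _ _ fr; rewrite !(exp3_edge a b c j).
  by have [-> ->] := edge _ _ _ _ frc; lra.
case=> j be /allpairsP[[j' be'] /= [_ be1 [-> ->]]].
have [a [b [c [fr /eqP->]]]] := exponents1_frame (ltn_ord j') be1.
by have := Y0 _ _ _ _ fr; rewrite /Y inord_val.
Qed.

(** On an edge [ab] let [A], [B] and [C] be the sums over the two faces of the pure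
coefficients at [a], at [b] and at the third vertex.  The tests [w_a^3 w_b] and
[w_a w_b^3] force [A = B] and [2 A + 5 C = 0], and then [w_a^2 w_b^2], which
gives [26 C = 12 A], forces [A = 0]. *)
Lemma face_moments2_inj (y : 'I_4 * seq nat -> R) :
  {in exponents 4 4, forall al, \sum_(t <- face_tests 2) face_moment al t * y t = 0} ->
  {in face_tests 2, forall t, y t = 0}.
Proof.
move=> y0; pose Y j be := y (inord j, be).
have edge j a b c : frame j a b c ->
    let mu p q r := moment 2 (Y j) (del j (exp3 a b c p q r)) in
    let x i := Y j (del j (exp1 i 2)) in
    [/\ Y j (del j (exp3 a b c 1 1 0)) = 3 / 2 * (x c - x a - x b),
      mu 3 1 0 = 30 * x a - 18 * x b + 30 * x c,
      mu 1 3 0 = 30 * x b - 18 * x a + 30 * x c &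
      mu 2 2 0 = 26 * x c - 6 * x a - 6 * x b].
  move=> fr; apply: (edge_moments2 fr); rewrite -(face_sum_bubble _ _ _ _ _ fr); apply: y0.
  - exact: (exp3_exponents 2 1 1 fr).
  - exact: (exp3_exponents 1 2 1 fr).
  - exact: (exp3_exponents 1 1 2 fr).
have Y0 : forall j a b c, frame j a b c -> Y j (del j (exp1 a 2)) = 0.
  apply: (opposite_vertices_eq0 (x := fun j a => Y j (del j (exp1 a 2)))).
  move=> j a b c fr; have frc := frame_swap fr.
  have := y0 _ (exp3_exponents 3 1 0 fr); have := y0 _ (exp3_exponents 1 3 0 fr).
  have := y0 _ (exp3_exponents 2 2 0 fr).
  rewrite !(face_sum_edge _ _ _ _ fr) -/(Y j) -/(Y c).
  have [_ -> -> ->] := edge _ _ _ _ fr; rewrite !(exp3_edge a b c j).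
  by have [_ -> -> ->] := edge _ _ _ _ frc; lra.
case=> j be /allpairsP[[j' be'] /= [_ be2 [-> ->]]].
have [a [b [c [fr /orP[]/eqP->]]]] := exponents2_frame (ltn_ord j') be2.
  by have := Y0 _ _ _ _ fr; rewrite /Y inord_val.
have [+ _ _ _] := edge _ _ _ _ fr; rewrite /Y inord_val => ->.
have e := Y0 j' _ _ _; rewrite /Y inord_val in e.
rewrite (e _ _ _ fr) (e b a c) ?(e c a b) ?subr0 ?mulr0 //.
  by apply: perm_trans fr; apply/permP => P /=; lia.
by apply: perm_trans fr; apply/permP => P /=; lia.
Qed.

End Moments.

(** * The Dirichlet integral over a triangle *)

Section Dirichlet.
Variable R : realType.
Local Notation mu := (@lebesgue_measure R).

Lemma integral_poly (p P : {poly R}) (a b : R) : a <= b -> deriv P = p ->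
  (\int[mu]_(x in `[a, b]) (p.[x])%:E = (P.[b] - P.[a])%:E)%E.
Proof.
rewrite le_eqVlt => /predU1P[<- _|ab dP].
  by rewrite set_itv1 integral_set1 subrr.
rewrite (@continuous_FTC2 _ _ (horner P) _ _ ab) //.
- apply: continuous_subspaceT => x; exact: continuous_horner.
- have cP x : {for x, continuous (horner P)} by exact: continuous_horner.
  split=> [x _||]; first exact: derivable_horner.
    exact: cvg_at_right_filter (cP a).
  exact: cvg_at_left_filter (cP b).
- by move=> x _; rewrite -derivE dP.
Qed.

(** An antiderivative is built by integration by parts, lowering the exponent [c] of
[s - X] while raising [b]; the boundary term vanishes at both 0 and [s]. *)
Lemma beta_antideriv (s : R) b c : exists G : {poly R},
  [/\ deriv G = 'X^b * (s%:P - 'X) ^+ c :> {poly R}, G.[0] = 0 &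
      G.[s] = s ^+ (b + c).+1 * ((b`! * c`!)%:R / ((b + c).+1)`!%:R)].
Proof.
elim: c b => [|c IHc] b.
  exists (b.+1%:R^-1 *: 'X^(b.+1)); split.
  - by rewrite derivZ derivXn expr0 mulr1 -scalerMnr scalerMnl -mulr_natr mulVf ?scale1r ?pnatr_eq0.
  - by rewrite hornerZ hornerXn expr0n mulr0.
  - rewrite hornerZ hornerXn addn0 mulrC muln1 factS natrM; congr (_ * _).
    by rewrite invfM mulrCA divff ?mulr1 // pnatr_eq0 -lt0n fact_gt0.
have [G [dG G0 Gs]] := IHc b.+1.
exists (b.+1%:R^-1 *: ('X^(b.+1) * (s%:P - 'X) ^+ c.+1 + c.+1%:R *: G)); split.
- rewrite derivZ derivD derivM derivZ dG derivXn deriv_exp derivB derivC derivX sub0r.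
  rewrite !scaler_nat mulN1r mulNrn mulrN mulrnAr addrNK mulrnAl /=.
  by rewrite -scalerMnr scalerMnl -mulr_natr mulVf ?scale1r ?pnatr_eq0.
- by rewrite !(hornerE, hornerZ, hornerM, hornerXn) G0 expr0n mul0r mulr0 addr0 mulr0.
- have s0 : (s%:P - 'X).[s] = 0 by rewrite !hornerE subrr.
  rewrite hornerZ hornerD hornerM !horner_exp s0 expr0n mulr0 add0r hornerZ Gs.
  rewrite addSnnS (factS b) (factS c).
  move: (b`!) (c`!) (((b + c.+1).+1)%N`!) (s ^+ _) => fb fc F sN; rewrite !natrM.
  move: (F%:R^-1 : R) => Fi; field; by rewrite nat1r pnatr_eq0.
Qed.

Lemma beta_integral (s : R) b c : 0 <= s ->
  (\int[mu]_(y in `[0%R, s]) (y ^+ b * (s - y) ^+ c)%:E =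
   (s ^+ (b + c).+1 * ((b`! * c`!)%:R / ((b + c).+1)`!%:R))%:E)%E.
Proof.
move=> s0; have [G [dG G0 Gs]] := beta_antideriv s b c.
rewrite -Gs; have := integral_poly s0 dG; rewrite G0 subr0 => <-; apply: eq_integral => y _.
by rewrite hornerM !horner_exp !hornerE.
Qed.

Lemma measurable_ref_triangle : measurable (@ref_triangle R).
Proof.
have -> : @ref_triangle R = (fst @^-1` `[0, +oo[) `&` (snd @^-1` `[0, +oo[) `&`
    ((fun z : R * R => z.1 + z.2) @^-1` `]-oo, 1]).
  apply/seteqP; split=> z; rewrite /ref_triangle /= !in_itv /= !andbT.
    by move=> [-> -> ->].
  by move=> [[-> ->] ->].
have mf (f : R * R -> R) (i : interval R) : measurable_fun setT f -> measurable (f @^-1` [set` i]).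
  by move=> mf; rewrite -[X in measurable X]setTI; apply: (mf measurableT); exact: measurable_itv.
apply: measurableI; last by apply: mf; apply: measurable_funD; [exact: measurable_fst|exact: measurable_snd].
by apply: measurableI; apply: mf; [exact: measurable_fst|exact: measurable_snd].
Qed.

Lemma ref_triangleE (x y : R) : ref_triangle (x, y) <->
  x \in `[0, 1]%R /\ y \in `[0, 1 - x]%R.
Proof.
rewrite /ref_triangle /= !in_itv /=; split=> [[x0 y0 xy]|[/andP[x0 x1] /andP[y0 y1]]].
  by split; apply/andP; split=> //; lra.
by split=> //; lra.
Qed.

(** The monomial with exponents [a], [b], [c] in the barycentric coordinates of the
reference triangle, in the order of the vertices (0, 0), (1, 0), (0, 1). *)
Definition triangle_mon (a b c : nat) (z : R * R) : R := (1 - z.1 - z.2) ^+ a * z.1 ^+ b * z.2 ^+ c.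

Lemma measurable_triangle_mon a b c D : measurable_fun D (triangle_mon a b c).
Proof.
apply: measurable_funTS.
have m1 : measurable_fun setT (fun z : R * R => z.1) := measurable_fst.
have m2 : measurable_fun setT (fun z : R * R => z.2) := measurable_snd.
by do 2?[apply: measurable_funM]; apply: measurable_funX => //; do 2?[apply: measurable_funB].
Qed.

Lemma triangle_mon_ge0 a b c z : ref_triangle z -> 0 <= triangle_mon a b c z.
Proof. by move=> [z1 z2 z3]; rewrite /triangle_mon !mulr_ge0 // exprn_ge0 //; lra. Qed.

(** By Tonelli, a Beta integral in the second coordinate, on the segment from 0 to
[1 - x], followed by one in the first coordinate. *)
Lemma dirichlet_integral a b c :
  (\int[(mu \x mu)%E]_(z in @ref_triangle R) (triangle_mon a b c z)%:E =
   ((a`! * b`! * c`!)%:R / ((a + b + c).+2)`!%:R)%:E)%E.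
Proof.
rewrite integral_mkcond fubini_tonelli1 /=; last 2 first.
- apply/(measurable_restrictT _ measurable_ref_triangle)/measurable_EFinP.
  exact: measurable_triangle_mon.
- by move=> z; rewrite patchE; case: ifPn => // /set_mem zt; rewrite lee_fin triangle_mon_ge0.
(* The inner integral at [x] is [k * x ^+ b * (1 - x) ^+ (c + a).+1]. *)
pose k : R := (c`! * a`!)%:R / ((c + a).+1)`!%:R.
transitivity (\int[mu]_(x in `[0%R, 1%R]) (k%:E * (x ^+ b * (1 - x) ^+ (c + a).+1)%:E)%E)%E.
  rewrite [RHS]integral_mkcond; apply: eq_integral => x _; rewrite /fubini_F patchE.
  case: ifPn => [/set_mem x01|/negP x01]; last first.
    rewrite integral0_eq // => y _; rewrite patchE; case: ifPn => // /set_mem.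
    by move=> /ref_triangleE[x01' _]; case: x01; exact/mem_set.
  have x1 : 0 <= 1 - x by move: x01; rewrite /= in_itv /= => /andP[_]; rewrite subr_ge0.
  transitivity (\int[mu]_(y in `[0%R, (1 - x)%R]) ((x ^+ b)%:E * (y ^+ c * (1 - x - y) ^+ a)%:E)%E)%E.
    rewrite [RHS]integral_mkcond; apply: eq_integral => y _; rewrite !patchE.
    have -> : ((x, y) \in @ref_triangle R) = (y \in `[0%R, 1 - x]%classic).
      apply/idP/idP => /set_mem.
        by move=> /ref_triangleE[_ yx]; exact/mem_set.
      by move=> yx; apply/mem_set/ref_triangleE.
    by case: ifP => // _; rewrite -EFinM /triangle_mon /=; congr EFin; ring.
  rewrite ge0_integralZl //.
  - by rewrite beta_integral // -!EFinM /k; congr EFin; ring.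
  - apply/measurable_EFinP; apply: measurable_funM; first exact: measurable_funX.
    by apply: measurable_funX; exact: measurable_funB.
  - move=> y; rewrite /= in_itv /= => /andP[y0 y1]; rewrite lee_fin mulr_ge0 ?exprn_ge0 //.
    by rewrite subr_ge0.
  - by move: x01; rewrite /= in_itv /= lee_fin => /andP[x0 _]; exact: exprn_ge0.
rewrite ge0_integralZl //.
- rewrite beta_integral // -EFinM expr1n mul1r /k; congr EFin.
  rewrite (_ : (b + (c + a).+1).+1 = (a + b + c).+2); last by lia.
  have F0 : ((c + a).+1)`!%:R != 0 :> R by rewrite pnatr_eq0 -lt0n fact_gt0.
  move: F0; move: (((c + a).+1)%N`!) (((a + b + c).+2)%N`!) (a`!) (b`!) (c`!).
  move=> F N fa fb fc F0; move: (N%:R^-1 : R) => Ni; by rewrite !natrM; field.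
- apply/measurable_EFinP; apply: measurable_funM; first exact: measurable_funX.
  by apply: measurable_funX; exact: measurable_funB.
- move=> y; rewrite /= in_itv /= => /andP[y0 y1]; rewrite lee_fin mulr_ge0 ?exprn_ge0 //.
  by rewrite subr_ge0.
- by rewrite lee_fin /k divr_ge0.
Qed.

End Dirichlet.

Section Surface.
Variable R : realType.
Local Notation mu := (@lebesgue_measure R).

Definition dirichlet_value (a b c : nat) : R := (a`! * b`! * c`!)%:R / ((a + b + c).+2)`!%:R.

Lemma integrable_triangle_mon a b c :
  (mu \x mu)%E.-integrable (@ref_triangle R) (EFin \o triangle_mon a b c).
Proof.
apply/integrableP; split; first by apply/measurable_EFinP; exact: measurable_triangle_mon.
under eq_integral => z /set_mem zt do rewrite /= ger0_norm ?triangle_mon_ge0 //.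
by rewrite dirichlet_integral ltry.
Qed.

Lemma Rintegral_triangle_mon_sum (I : Type) (s : seq I) (k : I -> R) (a b c : I -> nat) :
  Rintegral (mu \x mu)%E (@ref_triangle R)
    (fun z => \sum_(i <- s) k i * triangle_mon (a i) (b i) (c i) z) =
  \sum_(i <- s) k i * dirichlet_value (a i) (b i) (c i).
Proof.
have int_s r : (mu \x mu)%E.-integrable (@ref_triangle R)
    (EFin \o (fun z => \sum_(i <- r) k i * triangle_mon (a i) (b i) (c i) z)).
  rewrite (_ : _ \o _ = fun z => (\sum_(i <- r) (k i)%:E * (triangle_mon (a i) (b i) (c i) z)%:E)%E).
    apply: integrable_sum => //; first exact: measurable_ref_triangle.
    by move=> i _; apply: integrableZl; [exact: measurable_ref_triangle|exact: integrable_triangle_mon].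
  by apply/funext => z /=; rewrite -sumEFin; apply: eq_bigr => i _; rewrite EFinM.
elim: s => [|i s IHs].
  rewrite big_nil; under eq_Rintegral do rewrite big_nil.
  by rewrite Rintegral_cst ?mul0r //; exact: measurable_ref_triangle.
rewrite big_cons -IHs; under eq_Rintegral do rewrite big_cons.
rewrite RintegralD ?RintegralZl //; first by rewrite {1}/Rintegral dirichlet_integral.
- exact: measurable_ref_triangle.
- exact: integrable_triangle_mon.
- exact: measurable_ref_triangle.
- have := int_s [:: i]; congr (integrable _ _ _); apply/funext => z /=; by rewrite big_seq1.
Qed.

End Surface.

(** * Surface integrals *)

Section Geometry.
Variable R : realType.

Definition barycenter n d (a : 'I_n -> 'rV[R]_d) (w : 'I_n -> R) := \sum_i w i *: a i.

Definition convex_weights n (w : 'I_n -> R) := (forall i, 0 <= w i) /\ \sum_i w i = 1.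

Definition triangle_weights (z : R * R) (i : 'I_3) : R := [:: 1 - z.1 - z.2; z.1; z.2]`_i.

Lemma triangle_paramE (t : 'I_3 -> 'rV[R]_3) z :
  triangle_param t z = barycenter t (triangle_weights z).
Proof.
rewrite /triangle_param /triangle_edges /barycenter !rowK !big_ord_recl big_ord0 addr0 /=.
rewrite /triangle_weights /= (_ : ord_max = lift ord0 ord0 :> 'I_2); last exact: val_inj.
set u := t ord0; set v := t _; set w := t _; apply/rowP => i; rewrite !mxE; ring.
Qed.

Lemma triangle_weights_convex z : ref_triangle z -> convex_weights (triangle_weights z).
Proof.
move=> [z1 z2 z3]; split=> [[[|[|[|//]]] ?]|]; rewrite /triangle_weights /= ?z1 ?z2 //; first lra.
by rewrite !big_ord_recl big_ord0 /=; ring.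
Qed.

Lemma mon_triangle_weights z ga :
  mon (triangle_weights z) ga = triangle_mon (nth 0%N ga 0) (nth 0%N ga 1) (nth 0%N ga 2) z.
Proof. by rewrite /mon !big_ord_recl big_ord0 /= /triangle_mon /triangle_weights /= mulr1 mulrA. Qed.

Definition area_factor (t : 'I_3 -> 'rV[R]_3) : R :=
  Num.sqrt (\det (triangle_edges t *m (triangle_edges t)^T)).

Lemma surface_integral_mon (t : 'I_3 -> 'rV[R]_3) (f : 'rV[R]_3 -> R) (I : Type) (s : seq I)
    (k : I -> R) (g : I -> seq nat) :
  (forall w, convex_weights w -> f (barycenter t w) = \sum_(i <- s) k i * mon w (g i)) ->
  surface_integral t f = area_factor t * \sum_(i <- s) k i *
     dirichlet_value R (nth 0%N (g i) 0) (nth 0%N (g i) 1) (nth 0%N (g i) 2).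
Proof.
move=> fE; rewrite /surface_integral -Rintegral_triangle_mon_sum; congr (_ * _).
apply: eq_Rintegral => z /set_mem zt; rewrite triangle_paramE fE; last exact: triangle_weights_convex.
by apply: eq_bigr => i _; rewrite mon_triangle_weights.
Qed.

(** The Gram determinant is a sum of squares of minors, hence nonnegative; if it were
zero, some nonzero [v] would satisfy [|v E|^2 = v E E^T v^T = 0]. *)
Lemma gram_gt0 (E : 'M[R]_(2, 3)) : row_free E -> 0 < \det (E *m E^T).
Proof.
move=> fE; rewrite lt0r; apply/andP; split.
  apply/negP => /eqP d0; have : ~~ row_free (E *m E^T).
    by rewrite row_free_unit unitmxE d0 unitr0.
  rewrite -kermx_eq0 => /rowV0Pn[v /sub_kermxP vE v0]; case/negP: v0.
  rewrite -(mulmx_free_eq0 _ fE); apply/eqP/rowP => k; rewrite [RHS]mxE.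
  have : \sum_k ((v *m E) ord0 k) ^+ 2 = 0.
    have /matrixP/(_ ord0 ord0) : (v *m E) *m (v *m E)^T = 0.
      by rewrite trmx_mul -mulmxA (mulmxA E) (mulmxA v) vE mul0mx.
    by rewrite [RHS]mxE mxE => e; rewrite -[RHS]e; apply: eq_bigr => j _; rewrite [(_^T) _ _]mxE expr2.
  move/eqP; rewrite psumr_eq0 => [/allP/(_ k)|j _]; last exact: sqr_ge0.
  by rewrite mem_index_enum sqrf_eq0 => /(_ isT)/eqP.
pose e (i : 'I_2) (j : 'I_3) := E i j; pose r1 : 'I_2 := lift ord0 ord0.
pose j1 : 'I_3 := lift ord0 ord0; pose j2 : 'I_3 := lift ord0 (lift ord0 ord0).
have -> : \det (E *m E^T) =
    (e ord0 ord0 * e r1 j1 - e ord0 j1 * e r1 ord0) ^+ 2 +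
    (e ord0 ord0 * e r1 j2 - e ord0 j2 * e r1 ord0) ^+ 2 +
    (e ord0 j1 * e r1 j2 - e ord0 j2 * e r1 j1) ^+ 2.
  rewrite (expand_det_row _ ord0) !big_ord_recl !big_ord0 /cofactor !det_mx11 !mxE /=.
  rewrite !big_ord_recl !big_ord0 !mxE /=.
  have -> : lift ord0 0 = r1 by exact: val_inj.
  have -> : lift (lift ord0 ord0) 0 = ord0 :> 'I_2 by exact: val_inj.
  rewrite -/j1 -/j2 !addr0 /e; ring.
by rewrite !addr_ge0 ?sqr_ge0.
Qed.

End Geometry.

(** * Barycentric coordinates of a simplex *)

Section Simplex.
Variable R : realType.

Definition edge_matrix n d (a : 'I_n.+1 -> 'rV[R]_d) : 'M[R]_(n, d) :=
  \matrix_(i < n) (a (lift ord0 i) - a ord0).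

Lemma barycenter_edges n d (a : 'I_n.+1 -> 'rV[R]_d) w :
  barycenter a w = (\sum_i w i) *: a ord0 + (\row_k w (lift ord0 k)) *m edge_matrix a.
Proof.
rewrite /barycenter !big_ord_recl scalerDl -addrA mulmx_sum_row scaler_suml -big_split /=.
by congr (_ + _); apply: eq_bigr => k _; rewrite mxE rowK scalerBr addrCA subrr addr0.
Qed.

Lemma affine_independentP n d (a : 'I_n.+1 -> 'rV[R]_d) :
  affine_independent a <->
  (forall w, \sum_i w i = 0 -> barycenter a w = 0 -> forall i, w i = 0).
Proof.
split=> [fa w w0|aP].
  rewrite barycenter_edges w0 scale0r add0r => /eqP; rewrite mulmx_free_eq0 // => /eqP/rowP wl.
  have wl0 k : w (lift ord0 k) = 0 by have := wl k; rewrite !mxE.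
  move=> i; case: (unliftP ord0 i) => [k|] -> //.
  by move: w0; rewrite big_ord_recl big1 ?addr0 // => k _; rewrite wl0.
rewrite /affine_independent -kermx_eq0; apply/rowV0P => u /sub_kermxP uE.
(* The weight at the first vertex is chosen so that the weights have sum 0. *)
pose w (i : 'I_n.+1) := if unlift ord0 i is Some k then u ord0 k else - \sum_k u ord0 k.
have wl k : w (lift ord0 k) = u ord0 k by rewrite /w liftK.
have w0 : \sum_i w i = 0.
  by rewrite big_ord_recl (eq_bigr _ (fun k _ => wl k)) /w unlift_none addNr.
apply/rowP => k; rewrite mxE -wl; apply: aP => //.
rewrite barycenter_edges w0 scale0r add0r -[RHS]uE; congr (_ *m _).
by apply/rowP => i; rewrite mxE wl.
Qed.

Definition face_weights n (j : 'I_n.+1) (w : 'I_n -> R) (i : 'I_n.+1) : R :=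
  if unlift j i is Some k then w k else 0.

Lemma face_weights_lift n (j : 'I_n.+1) w k : face_weights j w (lift j k) = w k.
Proof. by rewrite /face_weights liftK. Qed.

Lemma face_weights_none n (j : 'I_n.+1) w : face_weights j w j = 0.
Proof. by rewrite /face_weights unlift_none. Qed.

Lemma barycenter_face n d (a : 'I_n.+1 -> 'rV[R]_d) j w :
  barycenter a (face_weights j w) = barycenter (fun i => a (lift j i)) w.
Proof.
rewrite /barycenter (bigD1_ord j) //= face_weights_none scale0r add0r.
by apply: eq_bigr => k _; rewrite face_weights_lift.
Qed.

Lemma sum_face_weights n (j : 'I_n.+1) w : \sum_i face_weights j w i = \sum_i w i.
Proof.
rewrite (bigD1_ord j) //= face_weights_none add0r.
by apply: eq_bigr => k _; rewrite face_weights_lift.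
Qed.

Lemma mon_face_weights n (j : 'I_n.+1) w al : size al = n.+1 ->
  mon (face_weights j w) al = if nth 0%N al j == 0%N then mon w (del j al) else 0.
Proof.
move=> sal; rewrite /mon (bigD1_ord j) //= face_weights_none expr0n.
case: eqP => _; rewrite ?mul0r ?mul1r //; apply: eq_bigr => k _.
rewrite face_weights_lift; congr (_ ^+ _); rewrite /del nth_cat size_take sal ltn_ord /bump.
case: ltnP => kj; first by rewrite nth_take.
by rewrite nth_drop addSn subnKC.
Qed.

Lemma affine_independent_face n d (a : 'I_n.+2 -> 'rV[R]_d) (j : 'I_n.+2) :
  affine_independent a -> affine_independent (fun i : 'I_n.+1 => a (lift j i)).
Proof.
move=> /affine_independentP aP; apply/affine_independentP => w w0 wa i.
by rewrite -(face_weights_lift j w); apply: aP; rewrite ?sum_face_weights ?barycenter_face.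
Qed.

(** With respect to the edges issued from the vertex [a ord0], the coordinates of [x]
are its barycentric coordinates except the first, which is then fixed by the
sum being 1. *)
Definition bary_coord n (a : 'I_n.+1 -> 'rV[R]_n) (x : 'rV[R]_n) (i : 'I_n.+1) : R :=
  let c := (x - a ord0) *m invmx (edge_matrix a) in
  if unlift ord0 i is Some k then c ord0 k else 1 - \sum_k c ord0 k.

Lemma bary_coordK n (a : 'I_n.+1 -> 'rV[R]_n) w : affine_independent a ->
  \sum_i w i = 1 -> bary_coord a (barycenter a w) = w.
Proof.
rewrite /affine_independent -/(edge_matrix a) row_free_unit => ua w1; apply/funext => i.
have cE : (barycenter a w - a ord0) *m invmx (edge_matrix a) = \row_k w (lift ord0 k).
  by rewrite barycenter_edges w1 scale1r addrAC subrr add0r mulmxK.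
rewrite /bary_coord cE; case: unliftP => [k|] ->; first by rewrite mxE.
by rewrite -w1 big_ord_recl; under [X in _ - X]eq_bigr do rewrite mxE; rewrite addrK.
Qed.

Lemma polyfun_bary_coord n (a : 'I_n.+1 -> 'rV[R]_n) i :
  PolyFun.polyfun 1 (fun x => bary_coord a x i).
Proof.
have cP k : PolyFun.polyfun 1 (fun x => ((x - a ord0) *m invmx (edge_matrix a)) ord0 k).
  apply: polyfun_ext (_ : PolyFun.polyfun 1 (fun x : 'rV[R]_n => \sum_l
     (x ord0 l + - a ord0 ord0 l) * invmx (edge_matrix a) l k)) => [x|].
    by rewrite mxE; apply: eq_bigr => l _; rewrite !mxE.
  apply: polyfun_sum => l _.
  apply: polyfun_ext (polyfunZ (invmx (edge_matrix a) l k)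
    (polyfunD (polyfun_coord _ l)
      (polyfun_cst _ 1 (- a ord0 ord0 l)))) => x; exact: mulrC.
rewrite /bary_coord; case: unlift => [k|]; first exact: cP.
apply: polyfunD; first exact: polyfun_cst.
apply: polyfun_ext (_ : PolyFun.polyfun 1 (fun x =>
  \sum_k -1 * ((x - a ord0) *m invmx (edge_matrix a)) ord0 k)) => [x|].
  by rewrite -mulr_sumr mulN1r.
by apply: polyfun_sum => k _; exact: polyfunZ.
Qed.

Lemma polyfun_mon_bary n p m (a : 'I_n.+1 -> 'rV[R]_n) (g : 'I_p -> 'I_n.+1) al :
  al \in exponents p m -> PolyFun.polyfun m (fun x => mon (fun i => bary_coord a x (g i)) al).
Proof.
rewrite mem_exponents => /andP[/eqP sal /eqP <-]; rewrite (sumn_ord sal).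
apply: polyfun_prod => i; rewrite -[X in PolyFun.polyfun X]mul1n.
exact/polyfunX/polyfun_bary_coord.
Qed.

(** The monomials in barycentric coordinates on the simplex, as functions extended
by 0 (Bernstein polynomials up to multinomial coefficients). *)
Definition bernstein n (a : 'I_n.+1 -> 'rV[R]_n) (al : seq nat) : 'rV[R]_n -> R^o :=
  patch (fun=> 0) (convex_hull a) (fun x => mon (bary_coord a x) al).

Lemma bernstein_sumE n (a : 'I_n.+1 -> 'rV[R]_n) (s : seq (seq nat)) (c : seq nat -> R) w :
  affine_independent a -> convex_weights w ->
  (\sum_(al <- s) c al *: bernstein a al) (barycenter a w) = \sum_(al <- s) c al * mon w al.
Proof.
move=> aI [w0 w1]; rewrite fct_sumE; apply: eq_bigr => al _.
rewrite -[LHS]/(c al * bernstein a al _) /bernstein patchE mem_set ?bary_coordK //.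
by exists w.
Qed.

Lemma bernstein_sum_out n (a : 'I_n.+1 -> 'rV[R]_n) (s : seq (seq nat)) (c : seq nat -> R) x :
  ~ convex_hull a x -> (\sum_(al <- s) c al *: bernstein a al) x = 0.
Proof.
move=> xT; rewrite fct_sumE big1 // => al _; rewrite -[LHS]/(c al * bernstein a al x).
by rewrite /bernstein patchE memNset ?mulr0.
Qed.

Lemma bernstein_free n m (a : 'I_n.+1 -> 'rV[R]_n) (c : seq nat -> R) :
  affine_independent a -> \sum_(al <- exponents n.+1 m) c al *: bernstein a al = 0 ->
  {in exponents n.+1 m, forall al, c al = 0}.
Proof.
move=> aI c0; apply: bform_eq0_simplex => w w0 w1; rewrite /bform -(bernstein_sumE _ _ aI) ?c0 //.
by split=> // i; exact: ltW.
Qed.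

Lemma Pspace_bernstein (a : 'I_4 -> 'rV[R]_3) m v : affine_independent a ->
  Pspace m (convex_hull a) v <->
  exists c : seq nat -> R, v = \sum_(al <- exponents 4 m) c al *: bernstein a al.
Proof.
move=> aI; split=> [[p pm ->]|[c ->]].
  have [c cE] := bernstein_expansion a pm; exists c; apply/funext => x; rewrite patchE.
  case: ifPn => [/set_mem[w [w0 w1 ->]]|/negP xT]; last first.
    by rewrite bernstein_sum_out // => xT'; apply: xT; exact/mem_set.
  by rewrite -[\sum_i _ *: _]/(barycenter a w) bernstein_sumE // -/(bform _ _ _) -cE.
exists (fun x => \sum_(al <- exponents 4 m) c al * mon (bary_coord a x) al).
  by apply: polyfun_sum => al alP; apply/polyfunZ/polyfun_mon_bary.
apply/funext => x; rewrite patchE; case: ifPn => [xT|/negP xT].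
  rewrite fct_sumE; apply: eq_bigr => al _.
  by rewrite -[LHS]/(c al * bernstein a al x) /bernstein patchE xT.
by rewrite bernstein_sum_out // => xT'; apply: xT; exact/mem_set.
Qed.

End Simplex.

(** * The bubble space *)

Section BubbleSpace.
Variables (R : realType) (a : 'I_4 -> 'rV[R]_3).
Hypothesis aI : affine_independent a.

Lemma size_del n j al : (j < n.+1)%N -> size al = n.+1 -> size (del j al) = n.
Proof. by move=> jn sal; rewrite /del size_cat size_take size_drop sal jn; lia. Qed.

Lemma sumn_del j al : (j < size al)%N -> nth 0%N al j = 0%N -> sumn (del j al) = sumn al.
Proof.
by move=> jal al0; rewrite -{2}(cat_take_drop j al) (drop_nth 0%N jal) al0 /del !sumn_cat.
Qed.

Definition add_exp (ga be : seq nat) := mkseq (fun i => nth 0 ga i + nth 0 be i)%N 3.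

Lemma mon_add_exp (w : 'I_3 -> R) ga be : mon w (add_exp ga be) = mon w ga * mon w be.
Proof. by rewrite /mon -big_split /=; apply: eq_bigr => i _; rewrite nth_mkseq // exprD. Qed.

Lemma dirichlet_value_add_exp m p ga be : ga \in exponents 3 m -> be \in exponents 3 p ->
  let e := add_exp ga be in
  dirichlet_value R (nth 0%N e 0) (nth 0%N e 1) (nth 0%N e 2) = dirichlet_weight R ga be / ((m + p).+2)`!%:R.
Proof.
rewrite !mem_exponents => /andP[/eqP sg /eqP mg] /andP[/eqP sb /eqP mb] /=.
rewrite /dirichlet_value /dirichlet_weight !big_ord_recl big_ord0 /= muln1 mulnA; congr (_ / _`!%:R).
by rewrite -mg -mb (sumn_ord sg) (sumn_ord sb) !big_ord_recl !big_ord0 /= !addn0 /bump !add1n; lia.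
Qed.

(** On the face, both factors are forms in its own barycentric coordinates, and all
the products of monomials that occur have the same degree [m + p], which is why
the factorial can be factored out. *)
Lemma bubble_face_integral m p (c d : seq nat -> R) j (q : 'rV[R]_3 -> R) :
  (forall w, convex_weights w ->
     q (barycenter (face_vertices a j) w) = \sum_(be <- exponents 3 p) d be * mon w be) ->
  surface_integral (face_vertices a j)
    (fun x => (\sum_(al <- exponents 4 m) c al *: bernstein a al) x * q x) =
  area_factor (face_vertices a j) / ((m + p).+2)`!%:R *
    \sum_(be <- exponents 3 p) d be * \sum_(al <- exponents 4 m) c al * face_moment R al (j, be).
Proof.
move=> qE.
rewrite (surface_integral_mon (s := [seq (al, be) | al <- exponents 4 m, be <- exponents 3 p])
  (k := fun x => (if nth 0%N x.1 j == 0%N then c x.1 else 0) * d x.2)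
  (g := fun x => add_exp (del j x.1) x.2)) => [|w ww].
  rewrite -mulrA; congr (_ * _); rewrite big_allpairs mulr_sumr exchange_big.
  apply: eq_big_seq => be beP; rewrite !mulr_sumr; apply: eq_big_seq => al alP.
  rewrite /face_moment /=; case: eqP => al0; last by rewrite !(mul0r, mulr0).
  have delP : del j al \in exponents 3 m.
    move: alP; rewrite !mem_exponents => /andP[/eqP sal /eqP <-].
    by rewrite (size_del (ltn_ord j) sal) sumn_del ?sal // !eqxx.
  rewrite (dirichlet_value_add_exp delP beP) /=; move: (_`!%:R^-1) => Fi; ring.
rewrite qE // -[barycenter _ _](barycenter_face a j w).
rewrite bernstein_sumE //; last first.
  case: ww => w0 w1; split; last by rewrite sum_face_weights.
  by move=> i; rewrite /face_weights; case: unlift.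
rewrite big_allpairs mulr_suml; apply: eq_big_seq => al; rewrite mem_exponents => /andP[/eqP sal _].
rewrite mulr_sumr; apply: eq_bigr => be _; rewrite (mon_face_weights _ _ sal) mon_add_exp /=.
by case: eqP => _; rewrite ?(mul0r, mulr0) // mulrACA.
Qed.

Lemma area_factor_neq0 j : area_factor (face_vertices a j) != 0.
Proof.
by rewrite gt_eqF // sqrtr_gt0 gram_gt0 //; exact: (affine_independent_face j aI).
Qed.

(** Testing with every polynomial on a face amounts to testing with the monomials of
degree [k.-1] in its barycentric coordinates, which span them. *)
Lemma bubble_spaceE k : bubble_space a k =
  [set v | exists c : seq nat -> R,
     {in face_tests k.-1, forall t, \sum_(al <- exponents 4 k.+1) c al * face_moment R al t = 0} /\
     v = \sum_(al <- exponents 4 k.+1) c al *: bernstein a al].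
Proof.
apply/seteqP; split=> v.
  move=> [/(Pspace_bernstein _ _ aI)[c ->] vq]; exists c; split=> // t.
  case/allpairsP=> -[j be] [_ beP ->].
  (* The coordinates of the tetrahedron extend those of the face. *)
  pose p x := mon (fun i => bary_coord a x (lift j i)) be.
  have pP : Pspace k.-1 (convex_hull (face_vertices a j))
      (patch (fun=> 0) (convex_hull (face_vertices a j)) p).
    by exists p => //; exact: polyfun_mon_bary.
  have := vq j _ pP.
  rewrite (bubble_face_integral k.+1 (p := k.-1) c (d := fun b : seq nat => (b == be :> seq nat)%:R)) => [/eqP|w [w0 w1]].
    by rewrite !mulf_eq0 (negPf (area_factor_neq0 j)) invr_eq0 pnatr_eq0 gtn_eqF ?fact_gt0 //
      (exponents_delta (fun b => \sum_(al <- _) c al * face_moment R al (j, b)) beP) => /eqP.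
  rewrite (exponents_delta (mon w) beP).
  rewrite patchE mem_set; last by exists w.
  rewrite /p -barycenter_face bary_coordK ?sum_face_weights //.
  by congr mon; apply/funext => i; rewrite face_weights_lift.
move=> [c [cK ->]]; split; first by apply/(Pspace_bernstein _ _ aI); exists c.
move=> j q [p pm ->]; have [d dE] := bernstein_expansion (face_vertices a j) pm.
rewrite (bubble_face_integral k.+1 (p := k.-1) c (d := d)) => [|w [w0 w1]].
  rewrite big_seq big1 ?mulr0 // => be beP; rewrite cK ?mulr0 //.
  by apply/allpairsP; exists (j, be); split=> //; rewrite mem_enum.
by rewrite patchE mem_set ?dE //; exists w.
Qed.

Lemma bubble_space_dim k :
  (forall y : 'I_4 * seq nat -> R,
    {in exponents 4 k.+1, forall al,
       \sum_(t <- face_tests k.-1) face_moment R al t * y t = 0} ->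
    {in face_tests k.-1, forall t, y t = 0}) ->
  has_dim (bubble_space a k) (size (exponents 4 k.+1) - size (face_tests k.-1)).
Proof.
move=> inj; rewrite bubble_spaceE; apply: has_dim_kernel => //.
- exact: exponents_uniq.
- apply: allpairs_uniq; rewrite ?enum_uniq ?exponents_uniq // => -[? ?] [? ?] _ _ /=.
  by case=> -> ->.
- by move=> c; exact: bernstein_free.
Qed.

End BubbleSpace.

Lemma size_face_tests p : size (face_tests p) = (4 * size (exponents 3 p))%N.
Proof. by rewrite size_allpairs size_enum_ord. Qed.

Theorem lemma1 (R : realType) (a : 'I_4 -> 'rV[R]_3) (ha : affine_independent a) :
  has_dim (bubble_space a 2) 8 /\ has_dim (bubble_space a 3) 11.
Proof.
split.
  have := bubble_space_dim ha (k := 2) (@face_moments1_inj R).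
  by rewrite size_face_tests.
have := bubble_space_dim ha (k := 3) (@face_moments2_inj R).
by rewrite size_face_tests.
Qed.
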